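(* Let $\alpha\geq 0$ be an integer, let $\beta\in\mathbb{R}$ with $\alpha\geq\beta\geq 0$, and let $n\ge 1$ be an integer. For a function $f$ on $[0,1]$ and $x\in[0,1)$ let $$\left(M_{n,\alpha+1}^{\alpha,\beta}f\right)(x):=(1-x)^{n+\alpha+1}\sum_{k=0}^{\infty}\binom{n+\alpha+k}{k}x^k f\left(\frac{k+\beta}{n+k+\alpha}\right),$$ and let $e_m(t):=t^m$. Then for every integer $m\ge 0$ and $x\in[0,1)$, $$\left(M_{n,\alpha+1}^{\alpha,\beta}e_m\right)(x)=\frac{(1-x)^{n+\alpha+1}}{(n+\alpha)!}\sum_{j=0}^{m}(-1)^j\binom{m}{j}(n+\alpha-\beta)^j\left(Li_j(x)\right)^{(n+\alpha)},$$ where $(\cdot)^{(n+\alpha)}$ denotes the derivative of order $n+\alpha$ with respect to $x$. Moreover, $M_{n,\alpha+1}^{\alpha,\beta}e_2$ is an elementary function.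
   Context: For integers $j\ge 0$ and $|x|<1$, $Li_j(x)=\sum_{k=1}^\infty\frac{x^k}{k^j}$; in particular $Li_0(x)=\frac{x}{1-x}$ and $Li_1(x)=-\log(1-x)$. The operators above are the case $r=\alpha+1$ of the generalized Meyer-König and Zeller operators $\left(M_{n,r}^{\alpha,\beta}f\right)(x)=(1-x)^{n+r}\sum_{k=0}^{\infty}\binom{n+r+k-1}{k}x^k f\left(\frac{k+\beta}{n+k+\alpha}\right)$. The convention $0^0=1$ is used. ''Elementary function'' means: on the interval $(0,1)$ it is given by a finite expression built from constants and the variable $x$ by arithmetic operations, compositions, real powers, exponentials and logarithms. *)

(* Defs.v *)
From Stdlib Require Import Reals Factorial.
From Coquelicot Require Import Coquelicot.
Open Scope R_scope.

(* The polylogarithm Li_j(x) = sum_{k >= 1} x^k / k^j; meaningful for |x| < 1. *)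
Definition Li (j : nat) (x : R) : R :=
  Series (fun k : nat => x ^ (S k) / INR (S k) ^ j).

(* [Binomial.C] is the real-valued binomial coefficient ([C] alone is
   Coquelicot's type of complex numbers).  For 1 <= n and 0 <= beta <= alpha
   the nodes (k + beta) / (n + k + alpha) lie in [0, 1], so only the values of
   [f] on [0, 1] matter. *)
Definition MKZ_term (alpha n : nat) (beta : R) (f : R -> R) (x : R) (k : nat)
  : R :=
  Binomial.C (n + alpha + k) k * x ^ k
  * f ((INR k + beta) / (INR n + INR k + INR alpha)).

Definition MKZ (alpha n : nat) (beta : R) (f : R -> R) (x : R) : R :=
  (1 - x) ^ (n + alpha + 1) * Series (MKZ_term alpha n beta f x).

(* [pow] satisfies 0 ^ 0 = 1. *)
Definition monomial (m : nat) (t : R) : R := t ^ m.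

Inductive elem_expr : Type :=
  | EConst (c : R)
  | EVar
  | EAdd (e1 e2 : elem_expr)
  | ESub (e1 e2 : elem_expr)
  | EMul (e1 e2 : elem_expr)
  | EDiv (e1 e2 : elem_expr)
  | EComp (e1 e2 : elem_expr)
  | EPow (e : elem_expr) (r : R)
  | EExp (e : elem_expr)
  | ELog (e : elem_expr).

(* [elem_val e x y]: the expression [e] is defined at [x], with value [y].
   A relation is used because [/ 0], [ln] and [Rpower] return arbitrary values
   outside their natural domains, which must not count as values of an
   expression.  Integer powers of negative bases are covered by [EMul] and
   [EDiv]. *)
Inductive elem_val : elem_expr -> R -> R -> Prop :=
  | val_const c x : elem_val (EConst c) x c
  | val_var x : elem_val EVar x x
  | val_add e1 e2 x y1 y2 :
      elem_val e1 x y1 -> elem_val e2 x y2 ->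
      elem_val (EAdd e1 e2) x (y1 + y2)
  | val_sub e1 e2 x y1 y2 :
      elem_val e1 x y1 -> elem_val e2 x y2 ->
      elem_val (ESub e1 e2) x (y1 - y2)
  | val_mul e1 e2 x y1 y2 :
      elem_val e1 x y1 -> elem_val e2 x y2 ->
      elem_val (EMul e1 e2) x (y1 * y2)
  | val_div e1 e2 x y1 y2 :
      elem_val e1 x y1 -> elem_val e2 x y2 -> y2 <> 0 ->
      elem_val (EDiv e1 e2) x (y1 / y2)
  | val_comp e1 e2 x y z :
      elem_val e2 x y -> elem_val e1 y z ->
      elem_val (EComp e1 e2) x z
  | val_pow e r x y :
      elem_val e x y -> 0 < y ->
      elem_val (EPow e r) x (Rpower y r)
  | val_pow_0 e r x :
      elem_val e x 0 -> 0 < r ->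
      elem_val (EPow e r) x 0
  | val_exp e x y :
      elem_val e x y -> elem_val (EExp e) x (exp y)
  | val_log e x y :
      elem_val e x y -> 0 < y -> elem_val (ELog e) x (ln y).

Definition elementary_on_01 (f : R -> R) : Prop :=
  exists e : elem_expr, forall x : R, 0 < x < 1 -> elem_val e x (f x).

(* Main.v *)
Require Import Defs.
From Stdlib Require Import Reals Factorial Lra Lia.
From Coquelicot Require Import Coquelicot.
Open Scope R_scope.

(** The node is [(k + beta) / (N + k) = 1 - (N - beta) / (N + k)] with
    [N = n + alpha], so its [m]-th power expands binomially in the powers
    [/ (N + k) ^ j]; and the coefficient of [x ^ k] in the [N]-th derivative of
    [Li j] is [(N + k)! / k! / (N + k) ^ j].  This gives the formula.  For [m = 2],
    differentiating [x * (Li (j + 1))' = Li j] repeatedly expresses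
    the derivatives of positive order of [Li 1] and [Li 2] through those of
    [Li 0] and through [Li 1 = - ln (1 - x)], by arithmetic operations only. *)

(** * Power series of the polylogarithms *)

(** The shift puts [0] at index [0], where the bare formula [/ INR k ^ j] would give [1] for
    [j = 0]. *)
Definition Li_coeff (j : nat) : nat -> R :=
  PS_incr_1 (fun k : nat => / INR (S k) ^ j : R_NormedModule).

Lemma Li_coeff_pos (j k : nat) : (1 <= k)%nat -> Li_coeff j k = / INR k ^ j.
Proof. destruct k; [lia | reflexivity]. Qed.

Lemma Li_PSeries (j : nat) (x : R) : Li j x = PSeries (Li_coeff j) x.
Proof.
  unfold Li_coeff; rewrite PSeries_incr_1; unfold Li, PSeries.
  rewrite <- Series_scal_l.
  apply Series_ext; intros k; simpl pow; unfold Rdiv; ring.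
Qed.

Lemma Li_coeff_bound (j k : nat) : Rabs (Li_coeff j k) <= 1.
Proof.
  destruct k as [|k].
  - unfold Li_coeff, PS_incr_1, zero; simpl; rewrite Rabs_R0; lra.
  - rewrite Li_coeff_pos by lia.
    assert (H : 1 <= INR (S k) ^ j).
    { apply pow_R1_Rle; rewrite S_INR; pose proof (pos_INR k); lra. }
    rewrite Rabs_right.
    + rewrite <- Rinv_1; apply Rinv_le_contravar; lra.
    + apply Rle_ge, Rlt_le, Rinv_0_lt_compat; lra.
Qed.

(** Coefficients bounded by [1] keep the terms bounded at the point [1], so the radius of
    convergence is at least [1]. *)
Lemma Li_radius (j : nat) (x : R) :
  Rabs x < 1 -> Rbar_lt (Rabs x) (CV_radius (Li_coeff j)).
Proof.
  intros Hx.
  apply Rbar_lt_le_trans with (Finite 1); [exact Hx |].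
  apply (proj1 (CV_radius_bounded (Li_coeff j))).
  exists 1; intros k; rewrite pow1, Rmult_1_r; apply Li_coeff_bound.
Qed.

(** This lets identities proved for all [Rabs y < 1] be differentiated at any point of the disk. *)
Lemma locally_unit_disk (x : R) :
  Rabs x < 1 -> locally x (fun y : R => Rabs y < 1).
Proof.
  intros Hx.
  assert (H : 0 < 1 - Rabs x) by lra.
  exists (mkposreal _ H); intros y Hy.
  change (Rabs (y - x) < 1 - Rabs x) in Hy.
  replace y with ((y - x) + x) by ring.
  pose proof (Rabs_triang (y - x) x); lra.
Qed.

Lemma ex_derive_n_Li (j p : nat) (x : R) : Rabs x < 1 -> ex_derive_n (Li j) p x.
Proof.
  intros Hx.
  apply ex_derive_n_ext with (PSeries (Li_coeff j)).
  - intros t; symmetry; apply Li_PSeries.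
  - apply ex_derive_n_PSeries, Li_radius, Hx.
Qed.

(** Termwise differentiation is valid inside the disk and preserves the radius of convergence. *)
Lemma is_series_Derive_n_Li (j p : nat) (x : R) :
  Rabs x < 1 ->
  is_series (fun k : nat => PS_derive_n p (Li_coeff j) k * x ^ k)
    (Derive_n (Li j) p x).
Proof.
  intros Hx.
  rewrite (Derive_n_ext _ (PSeries (Li_coeff j)) p x (Li_PSeries j)).
  rewrite Derive_n_PSeries by (apply Li_radius, Hx).
  apply Series_correct, ex_pseries_R, CV_radius_inside.
  rewrite CV_radius_derive_n; apply Li_radius, Hx.
Qed.

(** * Moments as finite combinations of derivatives *)

Lemma is_series_sum_f_R0 (F : nat -> nat -> R) (L : nat -> R) (m : nat) :
  (forall j : nat, (j <= m)%nat -> is_series (F j) (L j)) ->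
  is_series (fun k : nat => sum_f_R0 (fun j : nat => F j k) m) (sum_f_R0 L m).
Proof.
  induction m as [|m IH]; intros H; simpl.
  - apply H; lia.
  - apply (is_series_plus (V := R_NormedModule)).
    + apply IH; intros j Hj; apply H; lia.
    + apply H; lia.
Qed.

(** With [N = n + alpha], dividing the factor [(N + k)! / k!] produced by differentiation by [N!]
    gives exactly the binomial coefficient of the operator. *)
Lemma MKZ_term_monomial (alpha n : nat) (beta : R) (m : nat) (x : R) (k : nat) :
  (1 <= n)%nat ->
  MKZ_term alpha n beta (monomial m) x k
  = sum_f_R0 (fun j : nat =>
      (-1) ^ j * Binomial.C m j * (INR n + INR alpha - beta) ^ j
      / INR (fact (n + alpha))
      * (PS_derive_n (n + alpha) (Li_coeff j) k * x ^ k)) m.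
Proof.
  intros Hn.
  assert (HN : 0 < INR n + INR k + INR alpha).
  { pose proof (pos_INR k); pose proof (pos_INR alpha).
    apply lt_0_INR in Hn; lra. }
  unfold MKZ_term, monomial.
  (* The summand carrying the minus sign comes first because [binomial] gives the exponent [j] to
     its first summand. *)
  replace ((INR k + beta) / (INR n + INR k + INR alpha))
    with (-1 * ((INR n + INR alpha - beta) / (INR n + INR k + INR alpha)) + 1)
    by (field; lra).
  rewrite binomial, scal_sum.
  apply sum_eq; intros j _.
  unfold PS_derive_n.
  (* The index [k + (n + alpha)] is positive since [1 <= n], so the zero coefficient is never
     met. *)
  rewrite Li_coeff_pos by lia.
  rewrite pow1, !plus_INR, Rpow_mult_distr.
  unfold Rdiv at 1; rewrite Rpow_mult_distr, pow_inv.
  (* Only the coefficient of the operator is unfolded; [Binomial.C m j] stands on both sides and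
     stays opaque. *)
  unfold Binomial.C at 2.
  replace (n + alpha + k - k)%nat with (n + alpha)%nat by lia.
  replace (k + (n + alpha))%nat with (n + alpha + k)%nat by lia.
  replace (INR k + (INR n + INR alpha)) with (INR n + INR k + INR alpha) by ring.
  field; repeat split; try apply INR_fact_neq_0; apply pow_nonzero; lra.
Qed.

Lemma is_series_MKZ_term (alpha n : nat) (beta : R) (m : nat) (x : R) :
  (1 <= n)%nat -> Rabs x < 1 ->
  is_series (MKZ_term alpha n beta (monomial m) x)
    (sum_f_R0 (fun j : nat =>
      (-1) ^ j * Binomial.C m j * (INR n + INR alpha - beta) ^ j
      / INR (fact (n + alpha)) * Derive_n (Li j) (n + alpha) x) m).
Proof.
  intros Hn Hx.
  eapply is_series_ext.
  { intros k; symmetry; apply MKZ_term_monomial, Hn. }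
  apply is_series_sum_f_R0; intros j _.
  apply (is_series_scal (V := R_NormedModule)), is_series_Derive_n_Li, Hx.
Qed.

Lemma MKZ_monomial (alpha n : nat) (beta : R) (m : nat) (x : R) :
  (1 <= n)%nat -> Rabs x < 1 ->
  MKZ alpha n beta (monomial m) x
  = (1 - x) ^ (n + alpha + 1) / INR (fact (n + alpha))
    * sum_f_R0 (fun j : nat =>
        (-1) ^ j * Binomial.C m j * (INR n + INR alpha - beta) ^ j
        * Derive_n (Li j) (n + alpha) x) m.
Proof.
  intros Hn Hx.
  unfold MKZ.
  rewrite (is_series_unique _ _ (is_series_MKZ_term alpha n beta m x Hn Hx)).
  unfold Rdiv at 2; rewrite Rmult_assoc, (scal_sum _ _ (/ _)).
  f_equal; apply sum_eq; intros j _; unfold Rdiv; ring.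
Qed.

(** * Closed forms and the differential recurrence *)

Lemma Li_0 (x : R) : Rabs x < 1 -> Li 0 x = x / (1 - x).
Proof.
  intros Hx.
  unfold Li.
  rewrite (Series_ext _ (fun k : nat => x * x ^ k)).
  - rewrite Series_scal_l, Series_geom by exact Hx; reflexivity.
  - intros k; simpl; field.
Qed.

(** As [x / (1 - x) = / (1 - x) - 1], the pattern starts at order [1], where the constant has
    disappeared. *)
Lemma Derive_n_Li_0 (p : nat) (x : R) :
  Rabs x < 1 ->
  Derive_n (Li 0) (S p) x = INR (fact (S p)) / (1 - x) ^ S (S p).
Proof.
  revert x; induction p as [|p IH]; intros x Hx;
    assert (Hx1 : x < 1) by (apply Rabs_def2 in Hx; lra).
  - change (Derive (Li 0) x = INR (fact 1) / (1 - x) ^ 2).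
    rewrite (Derive_ext_loc _ (fun y : R => y / (1 - y))).
    + apply is_derive_unique; auto_derive; [lra |].
      simpl; field; lra.
    + apply filter_imp with (2 := locally_unit_disk x Hx); apply Li_0.
  - change (Derive (Derive_n (Li 0) (S p)) x
            = INR (fact (S (S p))) / (1 - x) ^ S (S (S p))).
    rewrite (Derive_ext_loc _
               (fun y : R => INR (fact (S p)) / (1 - y) ^ S (S p))).
    + change (fact (S (S p))) with (S (S p) * fact (S p))%nat.
      rewrite mult_INR; generalize (INR (fact (S p))); intros c.
      apply is_derive_unique; auto_derive.
      { apply (pow_nonzero _ (S (S p))); lra. }
      change (match p with O => 1 | S _ => INR p + 1 end) with (INR (S p)).
      change (1 + - x) with (1 - x).
      rewrite !S_INR; simpl pow.
      field; split; [apply pow_nonzero |]; lra.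
    + apply filter_imp with (2 := locally_unit_disk x Hx); exact IH.
Qed.

(** Termwise, [k * x ^ k / k ^ (j + 1) = x ^ k / k ^ j]. *)
Lemma Derive_Li_S (j : nat) (x : R) :
  Rabs x < 1 -> x * Derive (Li (S j)) x = Li j x.
Proof.
  intros Hx.
  rewrite (Derive_ext _ (PSeries (Li_coeff (S j)))) by apply Li_PSeries.
  rewrite Derive_PSeries by (apply Li_radius, Hx).
  rewrite Li_PSeries; unfold Li_coeff at 2; rewrite PSeries_incr_1.
  f_equal; apply PSeries_ext; intros k.
  unfold PS_derive; rewrite Li_coeff_pos by lia; rewrite <- tech_pow_Rmult.
  assert (INR (S k) <> 0) by (apply not_0_INR; lia).
  field; split; [apply pow_nonzero |]; assumption.
Qed.

(** By the product rule, each differentiation of [x * Derive_n (Li (S j)) (S p) x] yields one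
    further copy of the derivative of order [S p]; [INR p] counts these copies. *)
Lemma Derive_n_Li_S (j p : nat) (x : R) :
  Rabs x < 1 ->
  x * Derive_n (Li (S j)) (S p) x + INR p * Derive_n (Li (S j)) p x
  = Derive_n (Li j) p x.
Proof.
  revert x; induction p as [|p IH]; intros x Hx.
  - change (Derive_n (Li j) 0 x) with (Li j x).
    rewrite <- Derive_Li_S by exact Hx.
    change (Derive_n (Li (S j)) 1 x) with (Derive (Li (S j)) x).
    simpl INR; ring.
  - change (Derive_n (Li j) (S p) x) with (Derive (Derive_n (Li j) p) x).
    rewrite <- (Derive_ext_loc (fun y : R =>
      y * Derive_n (Li (S j)) (S p) y + INR p * Derive_n (Li (S j)) p y)).
    + symmetry; apply is_derive_unique.
      pose proof (ex_derive_n_Li (S j) (S p) x Hx) as H1.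
      pose proof (ex_derive_n_Li (S j) (S (S p)) x Hx) as H2.
      auto_derive; [repeat split; assumption |].
      change (Derive (fun y : R => Derive_n (Li (S j)) p y) x)
        with (Derive_n (Li (S j)) (S p) x).
      change (Derive (Derive_n (Li (S j)) p) x)
        with (Derive_n (Li (S j)) (S p) x).
      change (Derive (fun y : R => Derive (Derive_n (Li (S j)) p) y) x)
        with (Derive_n (Li (S j)) (S (S p)) x).
      rewrite S_INR; ring.
    + apply filter_imp with (2 := locally_unit_disk x Hx); exact IH.
Qed.

Lemma Li_at_0 (j : nat) : Li j 0 = 0.
Proof.
  rewrite Li_PSeries, PSeries_0; reflexivity.
Qed.

(** The function [Li 1 t + ln (1 - t)] has derivative zero on [[0, x]] and vanishes at [0]. *)
Lemma Li_1 (x : R) : 0 < x < 1 -> Li 1 x = - ln (1 - x).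
Proof.
  intros Hx.
  enough (H : Li 1 0 + ln (1 - 0) = Li 1 x + ln (1 - x)).
  { rewrite Li_at_0, Rminus_0_r, ln_1 in H; lra. }
  apply (eq_is_derive (fun t : R => Li 1 t + ln (1 - t))); [| lra].
  intros t Ht.
  assert (Hat : Rabs t < 1) by (apply Rabs_def1; lra).
  auto_derive.
  { split; [apply (ex_derive_n_Li 1 1 t Hat) | split; [lra | exact I]]. }
  (* At [t = 0] the relation [t * (Li 1)' = Li 0] carries no information, its
     derivative does. *)
  assert (H : Derive (Li 1) t = / (1 - t)).
  { destruct (Req_dec t 0) as [-> | Ht0].
    - pose proof (Derive_n_Li_S 0 1 0 Hat) as H.
      rewrite Derive_n_Li_0 in H by exact Hat.
      change (Derive_n (Li 1) 1 0) with (Derive (Li 1) 0) in H.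
      change (INR (fact 1)) with 1 in H; change (INR 1) with 1 in H.
      rewrite Rminus_0_r, pow1 in H; rewrite Rminus_0_r; lra.
    - pose proof (Derive_Li_S 0 t Hat) as H; rewrite Li_0 in H by exact Hat.
      apply Rmult_eq_reg_l with t; [rewrite H; reflexivity | exact Ht0]. }
  change (Derive (fun y : R => Li 1 y) t) with (Derive (Li 1) t).
  rewrite H; change (@zero R_NormedModule) with 0; field; lra.
Qed.

(** * Closure properties of elementary functions *)

Lemma elementary_ext (f g : R -> R) :
  (forall x : R, 0 < x < 1 -> f x = g x) ->
  elementary_on_01 f -> elementary_on_01 g.
Proof.
  intros H [e He]; exists e; intros x Hx; rewrite <- H by exact Hx; auto.
Qed.

Lemma elementary_const (c : R) : elementary_on_01 (fun _ => c).
Proof. exists (EConst c); intros; constructor. Qed.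

Lemma elementary_id : elementary_on_01 (fun x => x).
Proof. exists EVar; intros; constructor. Qed.

Lemma elementary_plus (f g : R -> R) :
  elementary_on_01 f -> elementary_on_01 g ->
  elementary_on_01 (fun x => f x + g x).
Proof.
  intros [e He] [e' He']; exists (EAdd e e'); intros; constructor; auto.
Qed.

Lemma elementary_minus (f g : R -> R) :
  elementary_on_01 f -> elementary_on_01 g ->
  elementary_on_01 (fun x => f x - g x).
Proof.
  intros [e He] [e' He']; exists (ESub e e'); intros; constructor; auto.
Qed.

Lemma elementary_mult (f g : R -> R) :
  elementary_on_01 f -> elementary_on_01 g ->
  elementary_on_01 (fun x => f x * g x).
Proof.
  intros [e He] [e' He']; exists (EMul e e'); intros; constructor; auto.
Qed.

Lemma elementary_div (f g : R -> R) :
  (forall x : R, 0 < x < 1 -> g x <> 0) ->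
  elementary_on_01 f -> elementary_on_01 g ->
  elementary_on_01 (fun x => f x / g x).
Proof.
  intros H [e He] [e' He']; exists (EDiv e e'); intros; constructor; auto.
Qed.

Lemma elementary_ln (f : R -> R) :
  (forall x : R, 0 < x < 1 -> 0 < f x) ->
  elementary_on_01 f -> elementary_on_01 (fun x => ln (f x)).
Proof.
  intros H [e He]; exists (ELog e); intros; constructor; auto.
Qed.

(** Repeated multiplication, unlike [EPow], puts no sign condition on the base. *)
Lemma elementary_pow (f : R -> R) (k : nat) :
  elementary_on_01 f -> elementary_on_01 (fun x => f x ^ k).
Proof.
  intros H; induction k as [|k IH]; simpl.
  - apply elementary_const.
  - apply elementary_mult; assumption.
Qed.

Lemma elementary_sum (F : nat -> R -> R) (m : nat) :
  (forall j : nat, (j <= m)%nat -> elementary_on_01 (F j)) ->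
  elementary_on_01 (fun x => sum_f_R0 (fun j : nat => F j x) m).
Proof.
  induction m as [|m IH]; intros H; simpl.
  - apply (H 0%nat); lia.
  - apply elementary_plus.
    + apply IH; intros j Hj; apply H; lia.
    + apply H; lia.
Qed.

Lemma elementary_one_minus : elementary_on_01 (fun x => 1 - x).
Proof. apply elementary_minus; [apply elementary_const | apply elementary_id]. Qed.

(** * Elementarity of the derivatives and of the second moment *)

Lemma Rabs_lt_1_on_01 (x : R) : 0 <= x < 1 -> Rabs x < 1.
Proof. intros Hx; apply Rabs_def1; lra. Qed.

Lemma elementary_Derive_n_Li_0 (p : nat) :
  elementary_on_01 (Derive_n (Li 0) (S p)).
Proof.
  apply elementary_ext
    with (fun x => INR (fact (S p)) / (1 - x) ^ S (S p)).
  - intros x Hx; symmetry; apply Derive_n_Li_0, Rabs_lt_1_on_01; lra.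
  - apply elementary_div.
    + intros x Hx; apply pow_nonzero; lra.
    + apply elementary_const.
    + apply elementary_pow, elementary_one_minus.
Qed.

(* The first derivative needs only [Li j], so the non-elementary [Li 2] itself
   never occurs. *)
Lemma elementary_Derive_n_Li_S (j : nat) :
  elementary_on_01 (Li j) ->
  (forall p : nat, elementary_on_01 (Derive_n (Li j) (S p))) ->
  forall p : nat, elementary_on_01 (Derive_n (Li (S j)) (S p)).
Proof.
  intros H0 H; induction p as [|p IH].
  - apply elementary_ext with (fun x => Li j x / x).
    + intros x Hx.
      rewrite <- Derive_Li_S by (apply Rabs_lt_1_on_01; lra).
      change (Derive_n (Li (S j)) 1 x) with (Derive (Li (S j)) x).
      field; lra.
    + apply elementary_div; [intros; lra | exact H0 | apply elementary_id].
  (* This is [Derive_n_Li_S] at order [S p], solved for its highest derivative. *)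
  - apply elementary_ext with (fun x =>
      (Derive_n (Li j) (S p) x
       - INR (S p) * Derive_n (Li (S j)) (S p) x) / x).
    + intros x Hx.
      rewrite <- Derive_n_Li_S by (apply Rabs_lt_1_on_01; lra).
      field; lra.
    + apply elementary_div; [intros; lra | | apply elementary_id].
      apply elementary_minus; [apply H |].
      apply elementary_mult; [apply elementary_const | exact IH].
Qed.

Lemma elementary_Li_0 : elementary_on_01 (Li 0).
Proof.
  apply elementary_ext with (fun x => x / (1 - x)).
  - intros x Hx; symmetry; apply Li_0, Rabs_lt_1_on_01; lra.
  - apply elementary_div; [intros; lra | apply elementary_id |].
    apply elementary_one_minus.
Qed.

Lemma elementary_Li_1 : elementary_on_01 (Li 1).
Proof.
  apply elementary_ext with (fun x => 0 - ln (1 - x)).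
  - intros x Hx; rewrite Li_1 by exact Hx; ring.
  - apply elementary_minus; [apply elementary_const |].
    apply elementary_ln; [intros; lra | apply elementary_one_minus].
Qed.

(** Passing from [j] to [S j] requires [Li j] itself to be elementary; this is available for [j = 0]
    and [j = 1], which reaches [Li 2]. *)
Lemma elementary_Derive_n_Li (j p : nat) :
  (j <= 2)%nat -> elementary_on_01 (Derive_n (Li j) (S p)).
Proof.
  intros Hj.
  pose proof (elementary_Derive_n_Li_S 0 elementary_Li_0
                elementary_Derive_n_Li_0) as H1.
  destruct j as [|[|[|j]]]; [apply elementary_Derive_n_Li_0 | apply H1 | | lia].
  apply elementary_Derive_n_Li_S; [apply elementary_Li_1 | exact H1].
Qed.

Lemma elementary_MKZ_monomial_2 (alpha n : nat) (beta : R) :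
  (1 <= n)%nat -> elementary_on_01 (MKZ alpha n beta (monomial 2)).
Proof.
  intros Hn.
  eapply elementary_ext.
  { intros x Hx; symmetry.
    apply MKZ_monomial; [exact Hn | apply Rabs_lt_1_on_01; lra]. }
  apply elementary_mult.
  - apply elementary_div.
    + intros _ _; apply INR_fact_neq_0.
    + apply elementary_pow, elementary_one_minus.
    + apply elementary_const.
  - apply (elementary_sum (fun j x =>
      (-1) ^ j * Binomial.C 2 j * (INR n + INR alpha - beta) ^ j
      * Derive_n (Li j) (n + alpha) x)).
    intros j Hj; apply elementary_mult; [apply elementary_const |].
    (* From [1 <= n] the order [n + alpha] is a successor, so only derivatives of positive order
       occur. *)
    destruct n as [|n]; [lia |].
    apply elementary_Derive_n_Li, Hj.
Qed.

(** [Series] and [Derive_n] are total functions; convergence and differentiability are therefore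
    asserted too, so that the formula does not equate default values. *)
Theorem mainTheorem7 (alpha n : nat) (beta : R)
  (Hn : (1 <= n)%nat) (Hbeta : 0 <= beta <= INR alpha) :
  (forall (m : nat) (x : R), 0 <= x < 1 ->
     ex_series (MKZ_term alpha n beta (monomial m) x)
     /\ (forall j : nat, (j <= m)%nat ->
           locally x (fun y : R => forall p : nat, (p <= n + alpha)%nat ->
                        ex_derive_n (Li j) p y))
     /\ MKZ alpha n beta (monomial m) x
        = (1 - x) ^ (n + alpha + 1) / INR (fact (n + alpha))
          * sum_f_R0 (fun j : nat =>
                        (-1) ^ j * Binomial.C m j
                        * (INR n + INR alpha - beta) ^ j
                        * Derive_n (Li j) (n + alpha) x) m)
  /\ elementary_on_01 (MKZ alpha n beta (monomial 2)).
Proof.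
  split; [intros m x Hx; apply Rabs_lt_1_on_01 in Hx; split; [| split] |].
  - eexists; apply is_series_MKZ_term; assumption.
  - intros j _.
    apply filter_imp with (2 := locally_unit_disk x Hx).
    intros y Hy p _; apply ex_derive_n_Li, Hy.
  - apply MKZ_monomial; assumption.
  - apply elementary_MKZ_monomial_2, Hn.
Qed.
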